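(* Let $n\ge2$ and let $X_1,\dots,X_n$ be random variables with one-dimensional cdf's $F_1,\dots,F_n$ whose joint cdf is absolutely continuous with respect to $\prod_{k=1}^nF_k(x_k)$. Let $\xi_1,\dots,\xi_n$ be independent random variables with cdf's $F_1,\dots,F_n$, and let $g_{i_1,\dots,i_c}$, $1\le i_1<\dots<i_c\le n$, $c=2,\dots,n$, be the canonical functions of the joint distribution of $X_1,\dots,X_n$. Then $X_1,\dots,X_n$ are (jointly) independent if and only if $$g_{i_1,\dots,i_c}(\xi_{i_1},\dots,\xi_{i_c})=0\ \text{(a.s.)}\quad\text{for all }1\le i_1<\dots<i_c\le n,\ c=2,\dots,n.$$
   Context: Canonical functions: if the joint cdf $F$ of $X_1,\dots,X_n$ is absolutely continuous with respect to the product of its marginals, i.e. $F(x_1,\dots,x_n)=\int_{-\infty}^{x_1}\cdots\int_{-\infty}^{x_n}G\,dF_1\cdots dF_n$ for some Borel $G\ge0$, then there exist Borel functions $g_{i_1,\dots,i_c}:\mathbf R^c\to\mathbf R$, $1\le i_1<\dots<i_c\le n$, $c=2,\dots,n$, with: (A1) $E|g_{i_1,\dots,i_c}(\xi_{i_1},\dots,\xi_{i_c})|<\infty$; (A2) $E(g_{i_1,\dots,i_c}(\xi_{i_1},\dots,\xi_{i_c})\mid\xi_{i_1},\dots,\xi_{i_{k-1}},\xi_{i_{k+1}},\dots,\xi_{i_c})=0$ (a.s.) for $k=1,\dots,c$; (A3) $U_n(\xi_1,\dots,\xi_n):=\sum_{c=2}^n\sum_{1\le i_1<\dots<i_c\le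 n}g_{i_1,\dots,i_c}(\xi_{i_1},\dots,\xi_{i_c})\ge-1$ (a.s.); and $$F(x_1,\dots,x_n)=\int_{-\infty}^{x_1}\cdots\int_{-\infty}^{x_n}(1+U_n(t_1,\dots,t_n))\prod_{i=1}^ndF_i(t_i).$$ The random variables $g_{i_1,\dots,i_c}(\xi_{i_1},\dots,\xi_{i_c})$ are a.s. uniquely determined by $F$. These $g_{i_1,\dots,i_c}$ are called here the canonical functions of the joint distribution. *)

(* Defs.v *)
From HB Require Import structures.
From mathcomp Require Import all_boot all_order all_algebra.
From mathcomp Require Import all_classical all_reals all_analysis.
Set Implicit Arguments.
Unset Strict Implicit.
Unset Printing Implicit Defensive.
Import Order.TTheory GRing.Theory Num.Theory.
Import numFieldNormedType.Exports.
Local Open Scope classical_set_scope.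
Local Open Scope ring_scope.

Definition mutually_independent (d : measure_display) (T : measurableType d)
    (R : realType) (P : probability T R) (I : finType) (X : I -> {RV P >-> R}) :=
  forall (J : {set I}) (B : I -> set R),
    (forall i, i \in J -> measurable (B i)) ->
    P [set w | forall i, i \in J -> B i (X i w)] =
    (\prod_(i in J) P (X i @^-1` B i))%E.

Definition joint_cdf (d : measure_display) (T : measurableType d)
    (R : realType) (P : probability T R) (n : nat) (X : 'I_n -> {RV P >-> R})
    (x : 'I_n -> R) : \bar R :=
  P [set w | forall i, X i w <= x i].

(* int_{-oo}^{x_0} ... int_{-oo}^{x_(n-1)} f(t) dmu_(n-1) ... dmu_0,
   the integral in the first coordinate being the outermost one. *)
Fixpoint iterated_integral (R : realType) (n : nat) :
    ('I_n -> {measure set R -> \bar R}) -> ('I_n -> R) ->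
    (n.-tuple R -> \bar R) -> \bar R :=
  match n with
  | 0 => fun _ _ f => f [tuple]
  | m.+1 => fun mu x f =>
      (\int[mu ord0]_(t in `]-oo, x ord0])
         iterated_integral (fun i => mu (lift ord0 i))
           (fun i => x (lift ord0 i)) (fun s => f [tuple of t :: s]))%E
  end.

(* dF_i: the Lebesgue-Stieltjes measure of the cdf of X_i is the law of X_i
   (lebesgue_stieltjes_cdf_id). *)
Definition marginals (d : measure_display) (T : measurableType d)
    (R : realType) (P : probability T R) (n : nat) (X : 'I_n -> {RV P >-> R}) :
    'I_n -> {measure set R -> \bar R} :=
  fun i => distribution P (X i).

(* The sigma-algebra on n.-tuple R is the product one, i.e. the Borel sets
   of R^n. *)
Definition joint_cdf_abs_continuous (d : measure_display)
    (T : measurableType d) (R : realType) (P : probability T R) (n : nat)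
    (X : 'I_n -> {RV P >-> R}) :=
  exists G : n.-tuple R -> R,
    [/\ measurable_fun setT G, (forall t, 0 <= G t) &
      forall x, joint_cdf X x =
        iterated_integral (marginals X) x (fun t => (G t)%:E)].

(* Y is a version of E(Z | S), for a sub-sigma-algebra S. *)
Definition is_cond_expectation (d : measure_display) (T : measurableType d)
    (R : realType) (P : probability T R) (Z : T -> R) (S : set (set T))
    (Y : T -> R) :=
  [/\ (forall B : set R, measurable B -> S (Y @^-1` B)),
      P.-integrable setT (EFin \o Y) &
      forall A, S A -> (\int[P]_(w in A) (Y w)%:E = \int[P]_(w in A) (Z w)%:E)%E].

(* The coordinates x_(i_1), ..., x_(i_c), where I = {i_1 < ... < i_c}:
   enum_val lists the elements of I in increasing order. *)
Definition subvector (R : Type) (n : nat) (I : {set 'I_n}) (x : 'I_n -> R) :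
    #|I|.-tuple R :=
  [tuple x (enum_val k) | k < #|I|].

(* The sigma-algebra generated by the X_i, i in I. *)
Definition sigma_of (d : measure_display) (T : measurableType d)
    (R : realType) (P : probability T R) (n : nat) (X : 'I_n -> {RV P >-> R})
    (I : {set 'I_n}) : set (set T) :=
  preimage_set_system setT (fun w => subvector I (fun i => X i w)) measurable.

(* Families g_{i_1, ..., i_c} are indexed by the sets I = {i_1 < ... < i_c};
   only the members with c >= 2 are meaningful. *)
Definition U_stat (R : realType) (n : nat)
    (g : forall I : {set 'I_n}, #|I|.-tuple R -> R) (x : 'I_n -> R) : R :=
  \sum_(2 <= c < n.+1) \sum_(I : {set 'I_n} | #|I| == c) g I (subvector I x).

Definition g_of (d : measure_display) (T : measurableType d)
    (R : realType) (Q : probability T R) (n : nat) (xi : 'I_n -> {RV Q >-> R})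
    (g : forall I : {set 'I_n}, #|I|.-tuple R -> R) (I : {set 'I_n}) : T -> R :=
  fun w => g I (subvector I (fun i => xi i w)).

Record canonical_functions (d d' : measure_display) (T : measurableType d)
    (T' : measurableType d') (R : realType) (P : probability T R)
    (Q : probability T' R) (n : nat) (X : 'I_n -> {RV P >-> R})
    (xi : 'I_n -> {RV Q >-> R})
    (g : forall I : {set 'I_n}, #|I|.-tuple R -> R) : Prop := {
  canonical_borel : forall I : {set 'I_n}, (2 <= #|I|)%N ->
    measurable_fun setT (g I);
  canonical_A1 : forall I : {set 'I_n}, (2 <= #|I|)%N ->
    ('E_Q[fun w => `|g_of xi g I w|%R] < +oo)%E;
  canonical_A2 : forall I : {set 'I_n}, (2 <= #|I|)%N ->
    forall k, k \in I ->
    is_cond_expectation Q (g_of xi g I) (sigma_of xi (I :\ k)) (cst 0);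
  canonical_A3 : {ae Q, forall w, -1 <= U_stat g (fun i => xi i w)};
  canonical_repr : forall x, joint_cdf X x =
    iterated_integral (marginals X) x
      (fun t => (1 + U_stat g (fun i => tnth t i))%:E)
}.

(* Main.v *)
Require Import Defs.
From HB Require Import structures.
From mathcomp Require Import all_boot all_order all_algebra.
From mathcomp Require Import all_classical all_reals all_analysis.
From mathcomp Require Import measurable_realfun.
Import Order.TTheory GRing.Theory Num.Theory.
Import numFieldNormedType.Exports.
Local Open Scope classical_set_scope.
Local Open Scope ring_scope.

(* Write mu for the law of (xi_1, ..., xi_n), the product of the marginals of
   X.  Fubini turns the canonical representation into
   F(x) = int_{t <= x} (1 + U) dmu.  The sets {t <= x} form a pi-system
   generating the Borel sets of R^n, so X is independent iff F(x) = mu{t <= x}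
   for all x, and then int_{t <= x} U dmu = 0 for all x, i.e. U = 0 mu-a.e.

   To recover each g_I from U, integrate U over {xi_i <= y_i, i in I}.  For
   J not contained in I, choose k in J \ I: by (A2) for J and k, and the
   independence of (xi_i)_{i in J} from (xi_i)_{i in I \ J}, the term g_J
   contributes 0.  By induction on |I| the terms g_J, J strictly contained in
   I, vanish a.s.; hence all these integrals of g_I are 0, and g_I = 0 a.s. *)

(** * Lower orthants: a pi-system generating the Borel sets of R^n *)

Definition lower_orthant {R : realType} {n} (x : 'I_n -> R) :
  set (n.-tuple R) := [set t | forall i, tnth t i <= x i].

Lemma lower_orthantI {R : realType} {n} (x y : 'I_n -> R) :
  lower_orthant x `&` lower_orthant y =
  lower_orthant (fun i => Num.min (x i) (y i)).
Proof.
apply/seteqP; split=> t /=.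
  by move=> [tx ty] i; rewrite le_min tx ty.
by move=> txy; split=> i; have := txy i; rewrite le_min => /andP[].
Qed.

Lemma lower_orthant_cover {R : realType} {n} :
  \bigcup_k lower_orthant (fun _ : 'I_n => k%:R : R) = setT.
Proof.
apply/seteqP; split=> // t _.
(* An integer that dominates every [|tnth t i|]. *)
exists (\big[maxn/0]_(i < n) Num.bound `|tnth t i|)%N => //= i.
apply: (le_trans (ler_norm _)); apply: (le_trans (ltW (archi_boundP _))) => //.
rewrite ler_nat; exact: (leq_bigmax (F := fun i => Num.bound `|tnth t i|)).
Qed.

(** Open right rays generate the Borel sets of the line, and closed left rays are their
    complements. *)
Lemma measurable_rays (R : realType) :
  @measurable _ (measurableTypeR R) =
  <<s range (fun x : R => [set` `]-oo, x]]) >>.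
Proof.
apply/seteqP; split; last first.
  by apply: smallest_sub; [exact: sigma_algebra_measurable|move=> _ [x _ <-]].
rewrite measurable_realfun.RGenOInfty.measurableE; apply: smallest_sub.
  exact: smallest_sigma_algebra.
move=> _ [x ->]; rewrite -setCitvl.
by apply: sigma_algebraC; apply: sub_sigma_algebra; exists x.
Qed.

Lemma measurable_lower_orthant {R : realType} {n} (x : 'I_n -> R) :
  measurable (lower_orthant x).
Proof.
have -> : lower_orthant x =
    \bigcap_(i in [set: 'I_n]) ((@tnth n R ^~ i) @^-1` `]-oo, x i]).
  apply/seteqP; split=> [t tx i _|t tx i] /=; first by rewrite in_itv/=.
  by have := tx i Logic.I; rewrite /= in_itv.
apply: fin_bigcap_measurable => // i _; rewrite -[X in measurable X]setTI.
exact: measurable_tnth.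
Qed.

Lemma measurable_lower_orthants (R : realType) n :
  @measurable _ (n.-tuple R) = <<s range (@lower_orthant R n) >>.
Proof.
apply/seteqP; split; last first.
  apply: smallest_sub; first exact: sigma_algebra_measurable.
  by move=> _ [x _ <-]; exact: measurable_lower_orthant.
(* A constraint on coordinate [i] alone is a countable union of orthants whose other bounds are the
   integers [k]. *)
have rayG i (x : R) :
    <<s range (@lower_orthant R n) >> ((@tnth n R ^~ i) @^-1` `]-oo, x]).
  have -> : (@tnth n R ^~ i) @^-1` `]-oo, x] =
      \bigcup_k lower_orthant (fun j => if j == i then x else k%:R).
    apply/seteqP; split=> [t /=|t [k _ /(_ i)]/=]; last by rewrite eqxx in_itv.
    rewrite in_itv/= => tx.
    exists (\big[maxn/0]_(i < n) Num.bound `|tnth t i|)%N => //= j.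
    case: eqP => [->//|_]; apply: (le_trans (ler_norm _)).
    apply: (le_trans (ltW (archi_boundP _))) => //.
    rewrite ler_nat; exact: (leq_bigmax (F := fun i => Num.bound `|tnth t i|)).
  apply: sigma_algebra_bigcup => k; apply: sub_sigma_algebra.
  by eexists.
apply: smallest_sub; first exact: smallest_sigma_algebra.
rewrite -bigcup_seq; apply: bigcup_sub => i _ _ [B mB <-].
have {}mB : <<s range (fun x : R => [set` `]-oo, x]]) >> B.
  by rewrite -measurable_rays.
(* The sets [B] whose preimage under the [i]-th coordinate lies in the generated sigma-algebra form
   a sigma-algebra themselves, so it is enough that it contains the rays. *)
suff : <<s range (fun x : R => [set` `]-oo, x]]) >> `<=`
    image_set_system setT (@tnth n R ^~ i) <<s range (@lower_orthant R n) >>.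
  by apply.
apply: smallest_sub => [|_ [x _ <-]].
  exact/sigma_algebra_image/smallest_sigma_algebra.
by rewrite /image_set_system/= setTI; exact: rayG.
Qed.

(** Uniqueness of measures on a generating pi-system; the orthants with integer bounds exhaust the
    space and have finite measure. *)
Lemma lower_orthant_measure_unique (R : realType) n
    (m1 m2 : {measure set (n.-tuple R) -> \bar R}) :
  (forall x, m1 (lower_orthant x) = m2 (lower_orthant x)) ->
  (forall x, (m1 (lower_orthant x) < +oo)%E) ->
  forall A, measurable A -> m1 A = m2 A.
Proof.
move=> m12 m1oo A mA.
apply: (measure_unique (range (@lower_orthant R n))
  (fun k => lower_orthant (fun=> k%:R))) => //.
- exact: measurable_lower_orthants.
- by move=> _ _ [x _ <-] [y _ <-]; rewrite lower_orthantI; eexists.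
- exact: lower_orthant_cover.
- by move=> _ [x _ <-]; exact: m12.
Qed.

(** * Iterated integrals as integrals against a product measure *)

Lemma measurable_fun_partial_integral d1 d2 (T1 : measurableType d1)
    (T2 : measurableType d2) (R : realType)
    (mu : {sigma_finite_measure set T2 -> \bar R}) (D : set T2)
    (f : T1 * T2 -> \bar R) : measurable D -> measurable_fun setT f ->
  measurable_fun setT (fun x => (\int[mu]_(y in D) f (x, y))%E).
Proof.
move=> mD mf.
(* Extension by zero moves [D] into the integrand; Tonelli then applies separately to the positive
   and negative parts. *)
pose h := f \_ (setT `*` D).
have mh : measurable_fun setT h.
  apply/(measurable_restrict _ _ _).1 => //; first exact: measurableX.
  exact: measurable_funS mf.
rewrite (_ : (fun x => _) = (fun x =>
  (\int[mu]_y h^\+ (x, y))%E - (\int[mu]_y h^\- (x, y))%E)%E).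
  apply: emeasurable_funB; apply: measurable_fun_fubini_tonelli_F => //.
  - exact: measurable_funepos.
  - exact: measurable_funeneg.
apply/funext => x; rewrite integral_mkcond integralE.
congr (_ - _)%E; apply: eq_integral => y _; rewrite ?funeposE ?funenegE;
  by rewrite /h !patchE in_setX in_setT.
Qed.

(* No integrability is assumed: Fubini makes the sections of an integrable
   function integrable only almost everywhere. *)
Lemma measurable_iterated_integral (R : realType) n
    (mu : 'I_n -> probability (R : measurableType _) R) (x : 'I_n -> R)
    d (S : measurableType d) (f : S * n.-tuple R -> \bar R) :
  measurable_fun setT f ->
  measurable_fun setT
    (fun s => iterated_integral (fun i => mu i) x (fun t => f (s, t))).
Proof.
elim: n mu x d S f => [|n IH] mu x d S f mf /=.
  exact: measurableT_comp.
(* The outermost variable joins the parameter, so the induction hypothesis is used over [S * R]. *)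
pose g (p : S * R) := iterated_integral (fun i => mu (lift ord0 i))
  (fun i => x (lift ord0 i)) (fun u => f (p.1, [tuple of p.2 :: u])).
have mg : measurable_fun setT g.
  apply: (IH _ _ _ _ (fun q : (S * R) * n.-tuple R =>
    f (q.1.1, [tuple of q.1.2 :: q.2]))).
  apply: measurableT_comp => //; apply: measurable_fun_pair => /=.
    exact: measurableT_comp.
  apply: measurable_cons => //; exact: measurableT_comp.
exact: (@measurable_fun_partial_integral _ _ _ _ _ (mu ord0) _ g).
Qed.

Lemma integrable_pushforwardW d1 d2 (X : measurableType d1)
    (Y : measurableType d2) (R : realType) (mu : {measure set X -> \bar R})
    (phi : X -> Y) (mphi : measurable_fun setT phi) (f : Y -> \bar R) :
  (pushforward mu phi).-integrable setT f -> mu.-integrable setT (f \o phi).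
Proof.
move=> /integrableP[mf foo]; apply/integrableP; split.
  exact: measurableT_comp.
move: foo; rewrite ge0_integral_pushforward//.
exact: measurableT_comp.
Qed.

Lemma measurable_cons_pair d (T : measurableType d) n :
  measurable_fun [set: T * n.-tuple T] (fun p => [tuple of p.1 :: p.2]).
Proof. exact: measurable_cons. Qed.

Lemma lower_orthant_cons (R : realType) n (x : 'I_n.+1 -> R) :
  (fun p : R * n.-tuple R => [tuple of p.1 :: p.2]) @^-1` lower_orthant x =
  `]-oo, x ord0] `*` lower_orthant (fun i => x (lift ord0 i)).
Proof.
apply/seteqP; split=> -[t s] /=; rewrite in_itv/=.
  by move=> h; split=> [|i]; [have := h ord0|have := h (lift ord0 i)];
    rewrite ?tnth0 ?tnthS.
by move=> [h0 h] i; case: (unliftP ord0 i) => [j ->|->]; rewrite ?tnth0 ?tnthS.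
Qed.

(** [pm] is the product of the [mu i], built one factor at a time as the image of [mu ord0 \x pm]
    under consing. Its values on orthants characterize it; the integral formula is Fubini. *)
Lemma iterated_integralE (R : realType) n
    (mu : 'I_n -> probability (R : measurableType _) R) :
  exists pm : probability (n.-tuple R) R,
    (forall x, pm (lower_orthant x) = (\prod_i mu i [set` `]-oo, x i]])%E) /\
    (forall x f, pm.-integrable setT f ->
      iterated_integral (fun i => mu i) x f =
      (\int[pm]_(t in lower_orthant x) f t)%E).
Proof.
elim: n mu => [|n IH] mu.
  (* The empty product is the unit mass at the empty tuple. *)
  exists (\d_ ([tuple] : 0.-tuple R)).
  have oT x : @lower_orthant R 0 x = setT by apply/seteqP; split=> // t _ [].
  split=> [x|x f /integrableP[mf _]].
    by rewrite big_ord0 oT probability_setT.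
  by rewrite /= oT integral_dirac// diracT mul1e.
have [pm [pm_prod pm_int]] := IH (fun i => mu (lift ord0 i)).
pose cons_fun := fun p : R * n.-tuple R => [tuple of p.1 :: p.2].
have mcons : measurable_fun setT cons_fun by exact: measurable_cons_pair.
pose cons_mixin := isMeasurableFun.Build _ _ _ _ _ mcons.
pose cons_mfun : {mfun _ >-> _} := HB.pack cons_fun cons_mixin.
pose P := (mu ord0 \x pm)%E.
exists (distribution P cons_mfun); split=> [x|x f intf] /=.
  rewrite /distribution /pushforward /= lower_orthant_cons.
  rewrite product_measure1E//; last exact: measurable_lower_orthant.
  by rewrite big_ord_recl; congr (_ * _)%E; exact: pm_prod.
have intfc : P.-integrable setT (f \o cons_fun).
  exact: integrable_pushforwardW intf.
have mf : measurable_fun setT f by case/integrableP: intf.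
pose x' i := x (lift ord0 i).
have mO : measurable (lower_orthant x') by exact: measurable_lower_orthant.
rewrite integral_pushforward//=; last 2 first.
- apply: integrableS intfc => //.
  by rewrite lower_orthant_cons; exact: measurableX.
- exact: measurable_lower_orthant.
pose h := (f \o cons_fun) \_ (`]-oo, x ord0] `*` lower_orthant x').
rewrite lower_orthant_cons [RHS]integral_mkcond.
transitivity (\int[mu ord0]_t fubini_F pm h t)%E; last first.
  apply: integral12_prod_meas1.
  apply/integrable_restrict => //; first exact: measurableX.
  by rewrite setTI; apply: integrableS intfc => //; exact: measurableX.
transitivity (\int[mu ord0]_(t in `]-oo, x ord0])
   \int[pm]_(s in lower_orthant x') (f \o cons_fun) (t, s))%E.
  (* The induction hypothesis needs an integrable section, which Fubini provides only for almost
     every [t]; both sides must therefore be shown measurable in [t]. *)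
  apply: ae_eq_integral => //.
  - apply: measurable_funTS.
    apply: (@measurable_iterated_integral _ _ _ _ _ _ (f \o cons_fun)).
    exact: measurableT_comp.
  - apply: measurable_funTS; apply: measurable_fun_partial_integral => //.
    exact: measurableT_comp.
  have := ae_integrable1 intfc; apply: filterS => t intt _.
  exact: pm_int.
rewrite integral_mkcond; apply: eq_integral => t _.
rewrite patchE /h; case: ifPn => tx; rewrite /fubini_F.
  rewrite [LHS]integral_mkcond; apply: eq_integral => s _.
  by rewrite !patchE in_setX tx.
rewrite integral0_eq// => s _.
by rewrite !patchE in_setX (negbTE tx).
Qed.

(** * Random vectors, their laws and joint cdfs *)

Section random_vector.
Context {R : realType} {d} {T : measurableType d} {P : probability T R}
  {n : nat}.
Variable X : 'I_n -> {RV P >-> R}.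

Definition random_vector (w : T) : n.-tuple R := [tuple X i w | i < n].

Lemma measurable_random_vector : measurable_fun setT random_vector.
Proof.
apply/measurable_fun_tnthP => i.
rewrite (_ : _ \o _ = X i)//; apply/funext => w /=.
by rewrite /random_vector tnth_mktuple.
Qed.

HB.instance Definition _ :=
  isMeasurableFun.Build _ _ _ _ random_vector measurable_random_vector.

Lemma random_vector_lower_orthant x :
  random_vector @^-1` lower_orthant x = [set w | forall i, X i w <= x i].
Proof.
by apply/seteqP; split=> w /= h i; have := h i; rewrite tnth_mktuple.
Qed.

Lemma measurable_lower_event (x : 'I_n -> R) :
  measurable [set w | forall i, X i w <= x i].
Proof.
rewrite -random_vector_lower_orthant -[X in measurable X]setTI.
by apply: measurable_random_vector => //; exact: measurable_lower_orthant.
Qed.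

Lemma joint_cdf_distribution x :
  joint_cdf X x = distribution P random_vector (lower_orthant x).
Proof. by rewrite /distribution /pushforward random_vector_lower_orthant. Qed.

Lemma independent_joint_cdf x : mutually_independent X ->
  joint_cdf X x = (\prod_i cdf (X i) (x i))%E.
Proof.
move=> /(_ [set: 'I_n]%SET (fun i => [set` `]-oo, x i]])).
rewrite /joint_cdf (_ : [set w | _] = [set w | forall i, X i w <= x i]).
  move=> -> //; apply: eq_big => [i|i _]; first by rewrite finset.in_setT.
  by [].
apply/seteqP; split=> w /= h i.
  by have := h i (finset.in_setT _); rewrite in_itv.
by rewrite in_itv/=.
Qed.

End random_vector.

(** * Functions determined by their integrals over orthants *)

Lemma density_measure d (T : measurableType d) (R : realType)
    (mu : {measure set T -> \bar R}) (f : T -> \bar R) :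
  measurable_fun setT f -> (forall t, 0 <= f t)%E ->
  exists nu : {measure set T -> \bar R},
    forall A, nu A = (\int[mu]_(t in A) f t)%E.
Proof.
move=> mf f0; pose nu A := (\int[mu]_(t in A) f t)%E.
have nu0 : nu set0 = 0%E by rewrite /nu integral_set0.
have nu_ge0 A : (0 <= nu A)%E by exact: integral_ge0.
have nu_sigma : semi_sigma_additive nu.
  exact: semi_sigma_additive_nng_induced.
pose nu_mixin := isMeasure.Build _ _ _ nu nu0 nu_ge0 nu_sigma.
pose nu_measure : {measure set T -> \bar R} := HB.pack nu nu_mixin.
by exists nu_measure.
Qed.

Lemma integral_eq0_funeposneg {d} {T : measurableType d} {R : realType}
    {mu : {measure set T -> \bar R}} {D : set T} {f : T -> \bar R} :
  measurable D -> mu.-integrable D f -> (\int[mu]_(t in D) f t = 0)%E ->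
  (\int[mu]_(t in D) f^\+ t = \int[mu]_(t in D) f^\- t)%E.
Proof.
move=> mD intf; rewrite integralE => /eqP.
rewrite sube_eq ?add0e ?fin_num_adde_defl//; first by move/eqP.
  by apply: integrable_fin_num => //; exact: integrable_funepos.
by apply: integrable_fin_num => //; exact: integrable_funeneg.
Qed.

(** The finite measures with densities [f^\+] and [f^\-] agree on orthants, hence on all Borel sets;
    so [f] integrates to 0 over every Borel set. *)
Lemma lower_orthant_integral_ae_eq0 (R : realType) n
    (mu : {measure set (n.-tuple R) -> \bar R}) (f : n.-tuple R -> R) :
  mu.-integrable setT (EFin \o f) ->
  (forall x, \int[mu]_(t in lower_orthant x) (f t)%:E = 0)%E ->
  {ae mu, forall t, f t = 0}.
Proof.
move=> intf f0; have mf := measurable_int _ intf.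
have [nup nupE] := @density_measure _ _ _ mu _ (measurable_funepos mf)
  (fun=> funepos_ge0 _ _).
have [nun nunE] := @density_measure _ _ _ mu _ (measurable_funeneg mf)
  (fun=> funeneg_ge0 _ _).
have intpos D : measurable D ->
    (\int[mu]_(t in D) (EFin \o f)^\+ t \is a fin_num)%E.
  move=> mD; apply: integrable_fin_num => //; apply: integrable_funepos => //.
  exact: integrableS intf.
have intneg D : measurable D ->
    (\int[mu]_(t in D) (EFin \o f)^\- t \is a fin_num)%E.
  move=> mD; apply: integrable_fin_num => //; apply: integrable_funeneg => //.
  exact: integrableS intf.
have nuE A : measurable A -> nup A = nun A.
  apply: lower_orthant_measure_unique => x.
    rewrite nupE nunE; apply: integral_eq0_funeposneg (f0 x).
      exact: measurable_lower_orthant.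
    by apply: integrableS intf => //; exact: measurable_lower_orthant.
  rewrite nupE ltey_eq intpos//; exact: measurable_lower_orthant.
have := @integral_ae_eq _ _ _ mu setT measurableT (cst 0%E) (EFin \o f) intf.
case=> // [E _ mE|].
  rewrite integral0 integralE -nupE -nunE nuE// subee// nunE; exact: intneg.
move=> N [mN N0 sN]; exists N; split=> // t /= ft; apply: sN => /= h.
by apply: ft; have := h Logic.I => -[].
Qed.

(** * Factoring out an independent event *)

Lemma independent_ge0_integral {R : realType} {n d} {T : measurableType d}
    {P : probability T R} {Y : {RV P >-> n.-tuple R}} {A : set T}
    {B : set (n.-tuple R)} {f : n.-tuple R -> \bar R} :
  measurable A -> measurable B ->
  (forall x, P (Y @^-1` lower_orthant x `&` A) =
    P A * P (Y @^-1` lower_orthant x))%E ->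
  measurable_fun setT f -> (forall t, 0 <= f t)%E ->
  (\int[P]_(w in Y @^-1` B `&` A) f (Y w) =
   P A * \int[P]_(w in Y @^-1` B) f (Y w))%E.
Proof.
move=> mA mB indep mf f0.
have mY : measurable_fun setT Y by [].
have mYB : measurable (Y @^-1` B).
  by rewrite -[X in measurable X]setTI; exact: mY.
have mfY : measurable_fun setT (f \o Y) by exact: measurableT_comp.
pose c : {nonneg R} := NngNum (fine_ge0 (measure_ge0 P A)).
have cE : (c%:num)%:E = P A by rewrite /= fineK// fin_num_measure.
pose PA := mrestr P mA.
(* Intersecting with [A] amounts to integrating against the restriction [PA] of [P], for which the
   complement of [A] is null. *)
transitivity (\int[PA]_(w in Y @^-1` B) (f \o Y) w)%E.
  rewrite (@ge0_negligible_integral _ _ _ PA _ (~` A) (f \o Y))//=.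
  - rewrite setDE setCK; apply: eq_measure_integral => C mC CA.
    by rewrite /= /PA /mrestr setIidl// => t /CA[].
  - exact: measurableC.
  - exact: measurable_funTS.
  - by rewrite /= /PA /mrestr setICl measure0.
rewrite -ge0_integral_pushforward//; last exact: measurable_funTS.
(* By independence the image of [PA] under [Y] is [P A] times the law of [Y]: the two agree on
   orthants. *)
rewrite (eq_measure_integral (mscale c (distribution P Y))); last first.
  move=> C mC _; apply: lower_orthant_measure_unique => // x.
    rewrite /= /mscale /= /pushforward /PA /mrestr.
    by rewrite /distribution /pushforward indep cE.
  rewrite /= /pushforward /PA /mrestr ltey_eq fin_num_measure//.
  apply: measurableI => //; rewrite -[X in measurable X]setTI.
  by apply: mY => //; exact: measurable_lower_orthant.
rewrite ge0_integral_mscale//; last exact: measurable_funTS.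
rewrite cE ge0_integral_pushforward//; exact: measurable_funTS.
Qed.

Lemma independent_integral_eq0 (R : realType) n d (T : measurableType d)
    (P : probability T R) (Y : {RV P >-> n.-tuple R}) (A : set T)
    (B : set (n.-tuple R)) (f : n.-tuple R -> R) :
  measurable A -> measurable B ->
  (forall x, P (Y @^-1` lower_orthant x `&` A) =
    P A * P (Y @^-1` lower_orthant x))%E ->
  measurable_fun setT f -> P.-integrable setT (EFin \o (f \o Y)) ->
  (\int[P]_(w in Y @^-1` B) (f (Y w))%:E = 0)%E ->
  (\int[P]_(w in Y @^-1` B `&` A) (f (Y w))%:E = 0)%E.
Proof.
move=> mA mB indep mf intf f0.
have mEf : measurable_fun setT (EFin \o f) by exact/measurable_EFinP.
have mYB : measurable (Y @^-1` B).
  by rewrite -[X in measurable X]setTI; exact: measurable_funP.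
have intB := integrableS measurableT mYB (@subsetT _ _) intf.
have fposE w : (EFin \o f)^\+%E (Y w) = (fun w => (f (Y w))%:E)^\+%E w.
  by rewrite !funeposE.
have fnegE w : (EFin \o f)^\-%E (Y w) = (fun w => (f (Y w))%:E)^\-%E w.
  by rewrite !funenegE.
have pos := independent_ge0_integral mA mB indep (measurable_funepos mEf)
  (fun=> funepos_ge0 _ _).
have neg := independent_ge0_integral mA mB indep (measurable_funeneg mEf)
  (fun=> funeneg_ge0 _ _).
rewrite integralE -(eq_integral _ _ (fun w _ => fposE w)) pos.
rewrite -(eq_integral _ _ (fun w _ => fnegE w)) neg.
rewrite (eq_integral _ _ (fun w _ => fposE w)).
rewrite (eq_integral _ _ (fun w _ => fnegE w)).
rewrite (integral_eq0_funeposneg mYB intB f0) subee//.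
rewrite fin_numM ?fin_num_measure//.
by apply: integrable_fin_num => //; exact: integrable_funeneg.
Qed.

(** * The canonical representation as an integral under [Q] *)

Lemma iterated_integral_marginals {R : realType} {n}
    {d} {T : measurableType d} {P : probability T R}
    (X : 'I_n -> {RV P >-> R})
    {d'} {T' : measurableType d'} {Q : probability T' R}
    (xi : 'I_n -> {RV Q >-> R}) (x : 'I_n -> R) (f : n.-tuple R -> \bar R) :
  mutually_independent xi ->
  (forall i r, cdf (xi i) r = cdf (X i) r) ->
  measurable_fun setT f -> Q.-integrable setT (f \o random_vector xi) ->
  iterated_integral (marginals X) x f =
  (\int[Q]_(w in [set w | forall i, (xi i w <= x i)%R])
    f (random_vector xi w))%E.
Proof.
move=> indep cdfE mf intf.
have [pm [pm_prod pm_int]] :=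
  @iterated_integralE R n (fun i => distribution P (X i)).
(* Independence of the [xi i] and equality of the marginal cdfs give both measures the same values
   on orthants. *)
have pmE A : measurable A -> pm A = distribution Q (random_vector xi) A.
  apply: lower_orthant_measure_unique => y.
    transitivity (joint_cdf xi y); last exact: joint_cdf_distribution.
    rewrite independent_joint_cdf//; apply: etrans (pm_prod y) _.
    by apply: eq_bigr => i _; rewrite cdfE.
  by rewrite ltey_eq fin_num_measure//; exact: measurable_lower_orthant.
have intpm : pm.-integrable setT f.
  apply/integrableP; split=> //.
  rewrite (eq_measure_integral (distribution Q (random_vector xi))); last first.
    by move=> A mA _; exact: pmE.
  rewrite ge0_integral_distribution//; last exact: measurableT_comp.
  by case/integrableP : intf.
rewrite [LHS](pm_int x f intpm).
rewrite (eq_measure_integral (distribution Q (random_vector xi))); last first.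
  by move=> A mA _; exact: pmE.
rewrite integral_pushforward//; last 2 first.
- apply: integrableS intf => //; rewrite random_vector_lower_orthant.
  exact: measurable_lower_event.
- exact: measurable_lower_orthant.
by rewrite random_vector_lower_orthant.
Qed.

(** After exchanging the sums, each [I] is met exactly at [c = #|I|], and [#|I|] never exceeds
    [n]. *)
Lemma U_statE (R : realType) n
    (g : forall I : {set 'I_n}, #|I|.-tuple R -> R) x :
  U_stat g x = \sum_(I : {set 'I_n} | (2 <= #|I|)%N) g I (subvector I x).
Proof.
rewrite /U_stat; under eq_bigr do rewrite big_mkcond.
rewrite exchange_big /= [RHS]big_mkcond; apply: eq_bigr => I _.
under eq_bigr do rewrite eq_sym.
rewrite -big_mkcond big_nat1_eq ltnS -[X in _ && (_ <= X)%N]card_ord.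
by rewrite max_card andbT.
Qed.

Section canonical.
Context {R : realType} {n : nat}
  {d} {T : measurableType d} {P : probability T R} {X : 'I_n -> {RV P >-> R}}
  {d'} {T' : measurableType d'} {Q : probability T' R}
  {xi : 'I_n -> {RV Q >-> R}}
  {g : forall I : {set 'I_n}, #|I|.-tuple R -> R}.
Hypotheses (indep : mutually_independent xi)
  (cdfE : forall i r, cdf (xi i) r = cdf (X i) r)
  (can : canonical_functions X xi g).

Lemma integrable_g_of (I : {set 'I_n}) : (2 <= #|I|)%N ->
  Q.-integrable setT (EFin \o g_of xi g I).
Proof.
move=> I2; apply/integrableP; split.
  apply/measurable_EFinP.
  have := measurable_random_vector (fun k : 'I_#|I| => xi (enum_val k)).
  by apply: measurableT_comp; exact: canonical_borel can _ I2.
by have := canonical_A1 can I2; rewrite unlock.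
Qed.

Lemma integrable_U_stat : Q.-integrable setT (fun w => (U_stat g (xi ^~ w))%:E).
Proof.
rewrite (_ : (fun w => _) = (fun w => \sum_(I : {set 'I_n} | (2 <= #|I|)%N)
    (g_of xi g I w)%:E)%E); last first.
  by apply/funext => w; rewrite U_statE sumEFin.
by apply: integrable_sum => // I I2; exact: integrable_g_of.
Qed.

Lemma measurable_U_stat_tuple :
  measurable_fun setT (fun t : n.-tuple R => U_stat g (tnth t)).
Proof.
rewrite (_ : (fun t => _) = (fun t : n.-tuple R => \sum_(I : {set 'I_n})
    if (2 <= #|I|)%N then g I (subvector I (tnth t)) else 0)); last first.
  by apply/funext => t; rewrite U_statE big_mkcond.
apply: measurable_sum => I; case: (boolP (2 <= #|I|)%N) => // I2.
apply: (measurableT_comp (canonical_borel can I2)).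
apply/measurable_fun_tnthP => k.
rewrite (_ : _ \o _ = @tnth n R ^~ (enum_val k)); last first.
  by apply/funext => t /=; rewrite tnth_mktuple.
exact: measurable_tnth.
Qed.

Lemma canonical_joint_cdf x :
  joint_cdf X x = (\int[Q]_(w in [set w | forall i, (xi i w <= x i)%R])
    (1 + U_stat g (xi ^~ w))%:E)%E.
Proof.
have tnth_xi w : tnth (random_vector xi w) = xi ^~ w.
  by apply/funext => i; rewrite tnth_mktuple.
rewrite (canonical_repr can) (iterated_integral_marginals _ _ _ _ indep cdfE).
- by under eq_integral do rewrite tnth_xi.
- apply/measurable_EFinP/measurable_funD => //.
  exact: measurable_U_stat_tuple.
rewrite (_ : _ \o _ = (fun w => 1 + (U_stat g (xi ^~ w))%:E)%E); last first.
  by apply/funext => w; rewrite /= tnth_xi.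
apply: integrableD => //; last exact: integrable_U_stat.
exact: finite_measure_integrable_cst.
Qed.

End canonical.

(** * Subfamilies of coordinates and their independence *)

Section coordinates.
Context {R : realType} {n : nat} {d} {T : measurableType d}
  {P : probability T R}.
Variable X : 'I_n -> {RV P >-> R}.

(** Convertible to the [subvector K] of the values of [X], so that [g_of xi g J] is [g J] composed
    with [coordinates xi J]. *)
Definition coordinates (K : {set 'I_n}) :=
  random_vector (fun k : 'I_#|K| => X (enum_val k)).

HB.instance Definition _ K := MeasurableFun.on (coordinates K).

(** Exhibits the event bounding the [X i], [i] in [K :&: I], as the preimage of a Borel set under
    [coordinates K]. *)
Definition lower_cylinder (K I : {set 'I_n}) (y : 'I_n -> R) :
    set (#|K|.-tuple R) :=
  [set t | forall k, enum_val k \in I -> tnth t k <= y (enum_val k)].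

Lemma measurable_lower_cylinder K I y : measurable (lower_cylinder K I y).
Proof.
have -> : lower_cylinder K I y =
    \bigcap_(k in [set k : 'I_#|K| | enum_val k \in I])
      ((@tnth _ R ^~ k) @^-1` `]-oo, y (enum_val k)]).
  by apply/seteqP; split=> t ty k kI; have := ty k kI; rewrite /= in_itv.
apply: fin_bigcap_measurable => // k _; rewrite -[X in measurable X]setTI.
exact: measurable_tnth.
Qed.

Lemma coordinates_lower_cylinder K I y :
  coordinates K @^-1` lower_cylinder K I y =
  [set w | forall i, i \in K :&: I -> X i w <= y i].
Proof.
apply/seteqP; split=> w /= h.
  move=> i /setIP[iK iI]; have := h (enum_rank_in iK i).
  by rewrite tnth_mktuple enum_rankK_in// => /(_ iI).
by move=> k kI; rewrite tnth_mktuple; apply: h; rewrite inE enum_valP.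
Qed.

Lemma measurable_lower_box (I : {set 'I_n}) (y : 'I_n -> R) :
  measurable [set w | forall i, i \in I -> X i w <= y i].
Proof.
rewrite -[in X in measurable X](finset.setTI I) -coordinates_lower_cylinder.
rewrite -[X in measurable X]setTI; apply: measurable_funP => //.
exact: measurable_lower_cylinder.
Qed.

(** The element [i0] makes [K] nonempty, as [enum_rank_in] requires to turn bounds indexed by ranks
    into bounds indexed by elements of [K]. *)
Lemma coordinates_lower_orthant {K : {set 'I_n}} {i0 : 'I_n}
    (i0K : i0 \in K) z :
  coordinates K @^-1` lower_orthant z =
  [set w | forall i, i \in K -> X i w <= z (enum_rank_in i0K i)].
Proof.
apply/seteqP; split=> w /= h.
  move=> i iK; have := h (enum_rank_in i0K i).
  by rewrite tnth_mktuple enum_rankK_in.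
move=> k; rewrite tnth_mktuple; have := h _ (enum_valP k).
by rewrite enum_valK_in.
Qed.

Lemma independent_coordinates (J I : {set 'I_n}) i0 (y : 'I_n -> R)
    (z : 'I_#|J| -> R) : mutually_independent X -> i0 \in J ->
  (P (coordinates J @^-1` lower_orthant z `&`
      [set w | forall i, i \in I :\: J -> (X i w <= y i)%R]) =
   P [set w | forall i, i \in I :\: J -> (X i w <= y i)%R] *
   P (coordinates J @^-1` lower_orthant z))%E.
Proof.
move=> indep i0J; rewrite (coordinates_lower_orthant i0J).
(* As [J] and [I :\: J] are disjoint, one family of bounds describes both events, and their
   intersection is a box over [J :|: I]. *)
pose u i := if i \in J then z (enum_rank_in i0J i) else y i.
pose B i : set R := [set` `]-oo, u i]].
have mB i : measurable (B i) by exact: measurable_itv.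
have E1 : [set w | forall i, i \in J -> X i w <= z (enum_rank_in i0J i)] =
    [set w | forall i, i \in J -> B i (X i w)].
  by apply/seteqP; split=> w /= h i iJ; have := h i iJ;
    rewrite /B /u iJ/= in_itv.
have E2 : [set w | forall i, i \in I :\: J -> X i w <= y i] =
    [set w | forall i, i \in I :\: J -> B i (X i w)].
  apply/seteqP; split=> w /= h i iIJ; have := h i iIJ; move: iIJ;
    by rewrite /B /u finset.in_setD => /andP[/negbTE -> _]; rewrite /= in_itv.
rewrite E1 E2 !indep// muleC.
have -> : [set w | forall i, i \in J -> B i (X i w)] `&`
    [set w | forall i, i \in I :\: J -> B i (X i w)] =
    [set w | forall i, i \in J :|: I -> B i (X i w)].
  apply/seteqP; split=> [w [/= hJ hI] i|w /= h].
    rewrite finset.in_setU; case: (boolP (i \in J)) => [/hJ//|iJ /= iI].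
    by apply: hI; rewrite finset.in_setD iJ.
  split=> i iX; apply: h; rewrite finset.in_setU ?iX//.
  by move: iX; rewrite finset.in_setD => /andP[_ ->]; rewrite orbT.
rewrite indep// (big_setID J)/=; congr (_ * _)%E; apply: eq_bigl => i.
  by rewrite finset.in_setI finset.in_setU; case: (i \in J); rewrite ?andbF.
by rewrite !finset.in_setD finset.in_setU; case: (i \in J).
Qed.

End coordinates.

Lemma ae_distribution {R : realType} {d d'} {T : measurableType d}
    {T' : measurableType d'} {P : probability T R} {Y : {RV P >-> T'}}
    {S : T' -> Prop} :
  {ae distribution P Y, forall t, S t} -> {ae P, forall w, S (Y w)}.
Proof.
move=> [N [mN N0 NS]]; exists (Y @^-1` N); split=> // [|w Sw]; last exact: NS.
by rewrite -[X in measurable X]setTI; exact: measurable_funP.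
Qed.

Lemma random_vector_ae_eq0 {R : realType} {n} {d} {T : measurableType d}
    {P : probability T R} (Y : {RV P >-> n.-tuple R}) (f : n.-tuple R -> R) :
  measurable_fun setT f -> P.-integrable setT (EFin \o (f \o Y)) ->
  (forall x, \int[P]_(w in Y @^-1` lower_orthant x) (f (Y w))%:E = 0)%E ->
  {ae P, forall w, f (Y w) = 0}.
Proof.
move=> mf intf f0; apply: (@ae_distribution _ _ _ _ _ P Y (fun t => f t = 0)).
have mEf : measurable_fun setT (EFin \o f) by exact/measurable_EFinP.
apply: lower_orthant_integral_ae_eq0 => [|x].
  by apply: integrable_pushforward.
rewrite integral_pushforward//; last exact: measurable_lower_orthant.
apply: integrableS intf => //; rewrite -[X in measurable X]setTI.
by apply: measurable_funP => //; exact: measurable_lower_orthant.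
Qed.

(** * Vanishing of the canonical functions under independence *)

Section independent_canonical.
Context {R : realType} {n : nat}
  {d} {T : measurableType d} {P : probability T R} {X : 'I_n -> {RV P >-> R}}
  {d'} {T' : measurableType d'} {Q : probability T' R}
  {xi : 'I_n -> {RV Q >-> R}}
  {g : forall I : {set 'I_n}, #|I|.-tuple R -> R}.
Hypotheses (indep : mutually_independent xi)
  (cdfE : forall i r, cdf (xi i) r = cdf (X i) r)
  (can : canonical_functions X xi g).

Let lower_box (I : {set 'I_n}) (y : 'I_n -> R) : set T' :=
  [set w | forall i, i \in I -> xi i w <= y i].

(** The constraints indexed by [I :\: J] are independent of the coordinates in [J] and factor out.
    Those left do not involve [k], so (A2) for [J] and [k] gives 0. *)
Lemma integral_g_of_lower_box (J I : {set 'I_n}) k y :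
  (2 <= #|J|)%N -> k \in J -> k \notin I ->
  (\int[Q]_(w in lower_box I y) (g_of xi g J w)%:E = 0)%E.
Proof.
move=> J2 kJ kI.
have -> : lower_box I y =
    coordinates xi J @^-1` lower_cylinder J I y `&` lower_box (I :\: J) y.
  rewrite coordinates_lower_cylinder.
  apply/seteqP; split=> [w h|w [h1 h2] i iI].
    split=> i; first by move=> /setIP[_ /h].
    by rewrite finset.in_setD => /andP[_ /h].
  have [iJ|iJ] := boolP (i \in J).
    by apply: h1; rewrite finset.in_setI iJ.
  by apply: h2; rewrite finset.in_setD iJ.
apply: (@independent_integral_eq0 _ _ _ _ Q (coordinates xi J)).
- exact: measurable_lower_box.
- exact: measurable_lower_cylinder.
- by move=> z; exact: independent_coordinates kJ.
- exact: canonical_borel can _ J2.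
- exact: integrable_g_of can _ J2.
have [_ _ condJ] := canonical_A2 can J2 kJ.
rewrite coordinates_lower_cylinder -condJ; first by rewrite integral0_eq.
(* The remaining event belongs to the sigma-algebra of the [xi i], [i] in [J :\ k], because [k] is
   not in [I]. *)
exists (lower_cylinder (J :\ k) I y); first exact: measurable_lower_cylinder.
rewrite setTI.
transitivity (coordinates xi (J :\ k) @^-1` lower_cylinder (J :\ k) I y) => //.
rewrite coordinates_lower_cylinder (_ : (J :\ k) :&: I = J :&: I)//.
apply/setP => i; rewrite !finset.in_setI finset.in_setD1.
by case: eqVneq => // ->; rewrite (negbTE kI) !andbF.
Qed.

Lemma ae_U_stat_eq0 : mutually_independent X ->
  {ae Q, forall w, U_stat g (xi ^~ w) = 0}.
Proof.
move=> indepX.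
have mO := measurable_lower_event xi.
have U0 x : (\int[Q]_(w in [set w | forall i, (xi i w <= x i)%R])
    (U_stat g (xi ^~ w))%:E = 0)%E.
  have intU := integrableS measurableT (mO x) (@subsetT _ _)
    (integrable_U_stat can).
  have := canonical_joint_cdf indep cdfE can x.
  (* The joint cdf of [X] is the product of the marginal cdfs, which is also the joint cdf of [xi];
     it then cancels against the integral of the constant 1. *)
  rewrite independent_joint_cdf// (eq_bigr _ (fun i _ => esym (cdfE i (x i)))).
  rewrite -independent_joint_cdf//.
  under eq_integral do rewrite EFinD.
  rewrite integralD//; last exact: finite_measure_integrable_cst.
  rewrite integral_cst// mul1e /joint_cdf.
  have cancel (q u : \bar R) : q \is a fin_num -> u \is a fin_num ->
      (q = q + u -> u = 0)%E.
    case: q u => [q| |] [u| |]// _ _ [].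
    by rewrite -{1}[q]addr0 => /addrI <-.
  apply: cancel; first exact: (fin_num_measure Q _ (mO x)).
  exact: integrable_fin_num intU.
have tnth_xi w : tnth (random_vector xi w) = xi ^~ w.
  by apply/funext => i; rewrite tnth_mktuple.
suff : {ae Q, forall w, U_stat g (tnth (random_vector xi w)) = 0}.
  by apply: filterS => w; rewrite tnth_xi.
apply: random_vector_ae_eq0 (measurable_U_stat_tuple can) _ _ => [|x].
  by rewrite (_ : _ \o _ = (fun w => (U_stat g (xi ^~ w))%:E));
    [exact: integrable_U_stat can|apply/funext => w /=; rewrite tnth_xi].
rewrite random_vector_lower_orthant -[RHS](U0 x).
by apply: eq_integral => w _; rewrite tnth_xi.
Qed.

Lemma ae_g_of_eq0 : mutually_independent X ->
  forall I : {set 'I_n}, (2 <= #|I|)%N -> {ae Q, forall w, g_of xi g I w = 0}.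
Proof.
(* Strong induction on [#|I|], through a strict upper bound [m]. *)
move=> indepX I; move: {2}_.+1 (ltnSn #|I|) => m.
elim: m I => // m IH I; rewrite ltnS => Im I2.
have gE0 (J : {set 'I_n}) D : measurable D -> (2 <= #|J|)%N ->
    {ae Q, forall w, g_of xi g J w = 0} ->
    (\int[Q]_(w in D) (g_of xi g J w)%:E = 0)%E.
  move=> mD J2 J0; rewrite -[RHS](integral0 Q D); apply: ae_eq_integral => //.
    apply: measurable_funTS.
    exact: measurable_int _ (integrable_g_of can _ J2).
  by apply: filterS J0 => w -> _.
have [i0 i0I] : exists i, i \in I by apply/card_gt0P; exact: leq_trans I2.
apply: (@random_vector_ae_eq0 _ _ _ _ Q (coordinates xi I)).
- exact: canonical_borel can _ I2.
- exact: integrable_g_of can _ I2.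
move=> z; rewrite (coordinates_lower_orthant _ i0I).
set D := [set w | _].
have mD : measurable D.
  exact: (measurable_lower_box xi I (z \o enum_rank_in i0I)).
(* On [D], which constrains exactly the coordinates in [I], the integral of [U_stat] reduces to that
   of the [I] term. *)
transitivity (\int[Q]_(w in D) (U_stat g (xi ^~ w))%:E)%E; last first.
  rewrite -[RHS](integral0 Q D); apply: ae_eq_integral => //.
    by apply: measurable_funTS; exact: measurable_int _ (integrable_U_stat can).
  by apply: filterS (ae_U_stat_eq0 indepX) => w -> _.
pose h (J : {set 'I_n}) w := (if (2 <= #|J|)%N then g_of xi g J w else 0)%:E.
rewrite [RHS](eq_integral (fun w => \sum_(J : {set 'I_n}) h J w)%E); last first.
  by move=> w _; rewrite U_statE big_mkcond sumEFin.
rewrite integral_sum//; last first.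
  move=> J; rewrite /h; case: (boolP (2 <= #|J|)%N) => J2.
    exact: integrableS measurableT mD _ (integrable_g_of can _ J2).
  exact: integrable0.
rewrite (bigD1 I)//= big1 ?adde0 => [|J JI].
  by apply: eq_integral => w _; rewrite /h I2.
rewrite /h; case: (boolP (2 <= #|J|)%N) => J2; last exact: integral0.
(* A proper subset of [I] is covered by induction; any other [J] has an element outside [I]. *)
have [JsubI|/subsetPn[k kJ kI]] := boolP (J \subset I).
  apply: gE0 => //; apply: IH => //.
  by apply: leq_trans Im; apply: proper_card; rewrite finset.properEneq JI.
exact: (@integral_g_of_lower_box J I k (z \o enum_rank_in i0I)).
Qed.

End independent_canonical.

(** * From the joint cdf back to independence, and the equivalence *)

Lemma same_joint_cdf_independent {R : realType} {n : nat}
    {d} {T : measurableType d} {P : probability T R} {X : 'I_n -> {RV P >-> R}}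
    {d'} {T' : measurableType d'} {Q : probability T' R}
    {xi : 'I_n -> {RV Q >-> R}} :
  mutually_independent xi -> (forall x, joint_cdf X x = joint_cdf xi x) ->
  mutually_independent X.
Proof.
move=> indep cdfE.
(* The joint cdf determines the joint law, and independence depends on that law only. *)
have lawE A : measurable A ->
    distribution P (random_vector X) A = distribution Q (random_vector xi) A.
  apply: lower_orthant_measure_unique => x.
    transitivity (joint_cdf X x); first by rewrite joint_cdf_distribution.
    by rewrite cdfE joint_cdf_distribution.
  rewrite ltey_eq fin_num_measure//; exact: measurable_lower_orthant.
have boxE d0 (T0 : measurableType d0) (P0 : probability T0 R)
    (Y : 'I_n -> {RV P0 >-> R}) (J : {set 'I_n}) (B : 'I_n -> set R) :
    [set w | forall i, i \in J -> B i (Y i w)] =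
    random_vector Y @^-1` [set t | forall i, i \in J -> B i (tnth t i)].
  by apply/seteqP; split=> w /= h i /h; rewrite tnth_mktuple.
have mbox (J : {set 'I_n}) (B : 'I_n -> set R) :
    (forall i, i \in J -> measurable (B i)) ->
    measurable [set t : n.-tuple R | forall i, i \in J -> B i (tnth t i)].
  move=> mB.
  have -> : [set t : n.-tuple R | forall i, i \in J -> B i (tnth t i)] =
      \bigcap_(i in [set i | i \in J]) ((@tnth n R ^~ i) @^-1` B i) by [].
  apply: fin_bigcap_measurable => // i iJ; rewrite -[X in measurable X]setTI.
  by apply: measurable_tnth => //; exact: mB.
have PQ (J : {set 'I_n}) (B : 'I_n -> set R) :
    (forall i, i \in J -> measurable (B i)) ->
    P [set w | forall i, i \in J -> B i (X i w)] =
    Q [set w | forall i, i \in J -> B i (xi i w)].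
  by move=> mB; rewrite !boxE; exact: lawE (mbox J B mB).
move=> J B mB; rewrite PQ// indep//; apply: eq_bigr => i iJ.
(* A one-coordinate event is a box over a singleton, so [PQ] also matches the factors of the
   product. *)
have single d0 (T0 : measurableType d0) (P0 : probability T0 R)
    (Y : 'I_n -> {RV P0 >-> R}) :
    Y i @^-1` B i = [set w | forall j, j \in [set i]%SET -> B j (Y j w)].
  apply/seteqP; split=> w /= h; first by move=> j /set1P ->.
  by apply: h; rewrite finset.in_set1.
by rewrite !single PQ// => j /set1P ->; exact: mB.
Qed.

Theorem theorem5p1 (R : realType) (n : nat)
    (d : measure_display) (T : measurableType d) (P : probability T R)
    (X : 'I_n -> {RV P >-> R})
    (d' : measure_display) (T' : measurableType d') (Q : probability T' R)
    (xi : 'I_n -> {RV Q >-> R})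
    (g : forall I : {set 'I_n}, #|I|.-tuple R -> R) :
  (2 <= n)%N ->
  joint_cdf_abs_continuous X ->
  mutually_independent xi ->
  (forall i r, cdf (xi i) r = cdf (X i) r) ->
  canonical_functions X xi g ->
  mutually_independent X <->
  (forall I : {set 'I_n}, (2 <= #|I|)%N ->
     {ae Q, forall w, g I (subvector I (fun i => xi i w)) = 0}).
Proof.
move=> _ _ indep cdfE can; split=> [indepX|g0].
  exact: ae_g_of_eq0 indep cdfE can indepX.
apply: (same_joint_cdf_independent indep) => x.
rewrite (canonical_joint_cdf indep cdfE can).
have mO := measurable_lower_event xi x.
rewrite (ae_eq_integral (cst 1%E)) ?integral_cst ?mul1e//.
  apply/measurable_funTS/measurable_EFinP/measurable_funD => //.
  by apply/measurable_EFinP; exact: measurable_int _ (integrable_U_stat can).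
(* There are finitely many [I], so one null set serves for all of them; outside it [U_stat] is 0 and
   the density is 1. *)
have U0 : {ae Q, forall w, forall I : {set 'I_n}, (2 <= #|I|)%N ->
    g I (subvector I (xi ^~ w)) = 0}.
  apply: filter_forall => I.
  have [I2|I2] := boolP (2 <= #|I|)%N; last exact: aeW.
  by apply: filterS (g0 I I2) => w ->.
apply: filterS U0 => w gw0 _; rewrite U_statE big1 ?addr0// => I; exact: gw0.
Qed.
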